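(* For all $z$ in a small neighborhood of $z=0$ the hypergeometric series satisfies the functional equations $$F\Bigl(\tfrac16,\tfrac12,1;\tfrac{3\sqrt3\,i\,z(1-z)}{(1+\omega z)^3}\Bigr)^2=-\omega^2F\bigl(\tfrac12,\tfrac12,1;z\bigr)^2-\omega F\bigl(\tfrac12,\tfrac12,1;\tfrac{z}{z-1}\bigr)^2,$$ $$F\Bigl(\tfrac16,\tfrac12,1;-\tfrac{3\sqrt3\,i\,z(1-z)}{(z+\omega)^3}\Bigr)^2=-\omega F\bigl(\tfrac12,\tfrac12,1;z\bigr)^2-\omega^2 F\bigl(\tfrac12,\tfrac12,1;\tfrac{z}{z-1}\bigr)^2,$$ $$F\Bigl(\tfrac1{12},\tfrac5{12},1;\tfrac{z^2}{4(z-1)}\Bigr)^2=F\bigl(\tfrac16,\tfrac12,1;z\bigr)\,F\bigl(\tfrac16,\tfrac12,1;\tfrac{z}{z-1}\bigr),$$ $$F\Bigl(\tfrac1{12},\tfrac5{12},1;\tfrac{27z^2(1-z)^2}{4(z^2-z+1)^3}\Bigr)^4=F\bigl(\tfrac12,\tfrac12,1;z\bigr)^4+F\bigl(\tfrac12,\tfrac12,1;\tfrac{z}{z-1}\bigr)^4-F\bigl(\tfrac12,\tfrac12,1;z\bigr)^2F\bigl(\tfrac12,\tfrac12,1;\tfrac{z}{z-1}\bigr)^2 .$$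
   Context: $i=\sqrt{-1}$, $\omega=\frac{-1+\sqrt3\, i}{2}$. The hypergeometric series is $F(a,b,c;z)=\sum_{n\ge0}\frac{(a,n)(b,n)}{(c,n)(1,n)}z^n$ for $|z|<1$, with $(a,n)=a(a+1)\cdots(a+n-1)$. *)

(* Defs.v *)
From Stdlib Require Import Reals.
From Coquelicot Require Import Coquelicot.

Open Scope C_scope.

Definition omega : C := (- 1 + RtoC (sqrt 3) * Ci) / 2.

(** [poch a n] is $(a,n) = a(a+1)\cdots(a+n-1)$. *)
Fixpoint poch (a : C) (n : nat) : C :=
  match n with
  | O => 1
  | S m => poch a m * (a + RtoC (INR m))
  end.

Definition hyp_coef (a b c : C) (n : nat) : C :=
  (poch a n * poch b n) / (poch c n * poch 1 n).

(** Coquelicot's [PSeries] is restricted to real power series. The complex sum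
    is obtained from [is_pseries] with [iota], in the way [RInt] is obtained
    from [is_RInt]; the value is meaningful only where the series converges. *)
Definition hypF (a b c z : C) : C :=
  iota (T := C_CompleteNormedModule) (fun l : C => is_pseries (hyp_coef a b c) z l).

Lemma hypF_unique (a b c z l : C) :
  is_pseries (hyp_coef a b c) z l -> hypF a b c z = l.
Proof.
intros Hl.
apply (iota_unique (V := C_CompleteNormedModule) (fun l : C => is_pseries (hyp_coef a b c) z l)); trivial.
intros y Hy.
exact (filterlim_locally_unique _ _ _ Hy Hl).
Qed.

(* Main.v *)
(** For [F = hypF a b 1] the logarithmic derivative [F'/F] is, near [0], a
    solution of the Riccati equation
    [z (1 - z) (y' + y^2) + (1 - (a + b + 1) z) y = a b].  For each pair of
    series to be compared, [hypF a b 1 (w z)] and [hypF c d 1 z], there is an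
    algebraic gauge factor with rational logarithmic derivative [lam] such
    that [(F'/F)(w z) w'] and [G'/G + lam] solve the same Riccati equation.
    The difference [D] of two solutions that are regular at [0] vanishes,
    because [U = z D] satisfies a linear equation [U' = k U] with [k] bounded
    and [U 0 = 0].  Hence the two sides of each identity have the same
    logarithmic derivative and the same value at [0]; comparing powers rather
    than the functions themselves avoids every choice of branch.  The gauge
    factors are [(1 + omega z)^(1/2)] for the first identity,
    [(1 - z)^(1/12)] for the third, [(z^2 - z + 1)^(1/4)] for the fourth and
    [(1 - z)^a] for Pfaff's transformation [z / (z - 1)]; the second identity
    is the first one for [omega^2]. *)

Require Import Defs.
From Stdlib Require Import Reals Lra.
From Coquelicot Require Import Coquelicot.
Open Scope C_scope.

(** * Complex derivatives and properties valid near [0] *)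

(** [C] is taken as a normed module over itself: its balls are the discs of [Cmod], so
    differentiability unfolds by conversion to inequalities between moduli. *)
Definition is_Cderive (f : C -> C) (z l : C) : Prop :=
  @is_derive C_AbsRing (AbsRing_NormedModule C_AbsRing) f z l.

(** Round discs are stable under multiplication by [t] in [[0, 1]] and are measured by [Cmod];
    [near0_locally] passes to the product balls of [locally] at the very end. *)
Definition near0 (P : C -> Prop) : Prop :=
  exists d : R, (0 < d)%R /\ forall z : C, (Cmod z < d)%R -> P z.

Lemma near0_imp (P Q : C -> Prop) :
  (forall z, P z -> Q z) -> near0 P -> near0 Q.
Proof. intros H [d [Hd HP]]; exists d; auto. Qed.

Lemma near0_and (P Q : C -> Prop) :
  near0 P -> near0 Q -> near0 (fun z => P z /\ Q z).
Proof.
intros [d [Hd HP]] [e [He HQ]]; exists (Rmin d e); split; [now apply Rmin_pos|].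
intros z Hz; pose proof (Rmin_l d e); pose proof (Rmin_r d e).
split; [apply HP|apply HQ]; lra.
Qed.

Lemma near0_center (P : C -> Prop) : near0 P -> P 0.
Proof. intros [d [Hd HP]]; apply HP; now rewrite Cmod_0. Qed.

Lemma is_Cderive_quadratic (f : C -> C) (z l : C) (K d : R) :
  (0 < d)%R ->
  (forall y, (Cmod (y - z) < d)%R ->
     (Cmod (f y - f z - (y - z) * l) <= K * Cmod (y - z) ^ 2)%R) ->
  is_Cderive f z l.
Proof.
intros Hd Hq.
split; [apply is_linear_scal_l|].
intros x Hx eps.
apply (@is_filter_lim_locally_unique C_AbsRing (AbsRing_NormedModule C_AbsRing)) in Hx.
subst x.
(* [Rabs K + 1] is a positive divisor dominating [K], whatever the sign of [K]. *)
assert (HK : (0 < Rabs K + 1)%R) by (pose proof (Rabs_pos K); lra).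
assert (He : (0 < Rmin d (eps / (Rabs K + 1)))%R).
{ apply Rmin_pos; trivial. apply Rdiv_lt_0_compat; trivial. apply cond_pos. }
exists (mkposreal _ He); intros y Hy.
change (Cmod (y - z) < Rmin d (eps / (Rabs K + 1)))%R in Hy.
change (Cmod (f y - f z - (y - z) * l) <= eps * Cmod (y - z))%R.
eapply Rle_trans; [apply Hq; eapply Rlt_le_trans; [exact Hy|apply Rmin_l]|].
assert (Hy2 : (Cmod (y - z) < eps / (Rabs K + 1))%R).
{ eapply Rlt_le_trans; [exact Hy|apply Rmin_r]. }
apply Rlt_div_r in Hy2; [|exact HK].
pose proof (Cmod_ge_0 (y - z)); pose proof (Rle_abs K).
nra.
Qed.

Lemma is_Cderive_eps (f : C -> C) (z l : C) :
  is_Cderive f z l -> forall eps : posreal, exists d : R, (0 < d)%R /\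
  forall y, (Cmod (y - z) < d)%R ->
     (Cmod (f y - f z - (y - z) * l) <= eps * Cmod (y - z))%R.
Proof.
intros [_ H] eps.
destruct (H z (fun P HP => HP) eps) as [d Hd].
exists d; split; [apply cond_pos|].
intros y Hy; exact (Hd y Hy).
Qed.

Lemma is_Cderive_eq (f : C -> C) (z l l' : C) :
  is_Cderive f z l -> l = l' -> is_Cderive f z l'.
Proof. now intros H <-. Qed.

Lemma is_Cderive_const (c z : C) : is_Cderive (fun _ => c) z 0.
Proof. exact (@is_derive_const C_AbsRing (AbsRing_NormedModule C_AbsRing) c z). Qed.

Lemma is_Cderive_id (z : C) : is_Cderive (fun x => x) z 1.
Proof. exact (@is_derive_id C_AbsRing z). Qed.

Lemma is_Cderive_plus (f g : C -> C) (z l m : C) :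
  is_Cderive f z l -> is_Cderive g z m -> is_Cderive (fun x => f x + g x) z (l + m).
Proof. exact (@is_derive_plus C_AbsRing (AbsRing_NormedModule C_AbsRing) f g z l m). Qed.

Lemma is_Cderive_opp (f : C -> C) (z l : C) :
  is_Cderive f z l -> is_Cderive (fun x => - f x) z (- l).
Proof. exact (@is_derive_opp C_AbsRing (AbsRing_NormedModule C_AbsRing) f z l). Qed.

Lemma is_Cderive_minus (f g : C -> C) (z l m : C) :
  is_Cderive f z l -> is_Cderive g z m -> is_Cderive (fun x => f x - g x) z (l - m).
Proof. exact (@is_derive_minus C_AbsRing (AbsRing_NormedModule C_AbsRing) f g z l m). Qed.

Lemma is_Cderive_mult (f g : C -> C) (z l m : C) :
  is_Cderive f z l -> is_Cderive g z m ->
  is_Cderive (fun x => f x * g x) z (l * g z + f z * m).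
Proof.
intros Hf Hg.
exact (@is_derive_mult C_AbsRing f g z l m Hf Hg Cmult_comm).
Qed.

Lemma is_Cderive_comp (f g : C -> C) (z l m : C) :
  is_Cderive f (g z) l -> is_Cderive g z m -> is_Cderive (fun x => f (g x)) z (m * l).
Proof. exact (@is_derive_comp C_AbsRing (AbsRing_NormedModule C_AbsRing) f g z l m). Qed.

(** The coefficient goes through [Z] so that, for a concrete exponent, it computes to a numeral that
    [field] understands. *)
Lemma is_Cderive_pow (f : C -> C) (n : nat) (z l : C) :
  is_Cderive f z l ->
  is_Cderive (fun x => f x ^ S n) z (RtoC (IZR (Z.of_nat (S n))) * f z ^ n * l).
Proof.
intros Hf; rewrite <- INR_IZR_INZ; induction n as [|n IH].
- eapply is_Cderive_eq; [exact (is_Cderive_mult f (fun _ => 1) z l 0 Hf (is_Cderive_const _ _))|].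
  simpl; ring.
- eapply is_Cderive_eq; [exact (is_Cderive_mult _ _ _ _ _ Hf IH)|].
  rewrite (S_INR (S n)), RtoC_plus; cbn [Cpow]; ring.
Qed.

Lemma is_Cderive_near0 (f : C -> C) (l : C) (e : R) :
  is_Cderive f 0 l -> (0 < e)%R -> near0 (fun z => (Cmod (f z - f 0%C) < e)%R).
Proof.
intros H He.
destruct (is_Cderive_eps _ _ _ H (mkposreal 1 Rlt_0_1)) as [d [Hd Hb]]; simpl in Hb.
pose proof (Cmod_ge_0 l) as Hl.
assert (Hc : (0 < 1 + Cmod l)%R) by lra.
exists (Rmin d (e / (1 + Cmod l))); split.
{ apply Rmin_pos; trivial; now apply Rdiv_lt_0_compat. }
intros z Hz.
pose proof (Rlt_le_trans _ _ _ Hz (Rmin_l _ _)) as Hz1.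
pose proof (Rlt_le_trans _ _ _ Hz (Rmin_r _ _)) as Hz2.
apply Rlt_div_r in Hz2; trivial.
specialize (Hb z); replace (z - 0) with z in Hb by ring; specialize (Hb Hz1).
pose proof (Cmod_triangle (f z - f 0 - z * l) (z * l)) as Ht.
rewrite (Cmod_mult z l) in Ht.
replace (f z - f 0 - z * l + z * l) with (f z - f 0) in Ht by ring; lra.
Qed.

Lemma near0_comp (w : C -> C) (l : C) (P : C -> Prop) :
  is_Cderive w 0 l -> w 0 = 0 -> near0 P -> near0 (fun z => P (w z)).
Proof.
intros H H0 [d [Hd HP]].
apply (near0_imp (fun z => (Cmod (w z - w 0%C) < d)%R)); [|now apply (is_Cderive_near0 w l)].
intros z Hz; apply HP; rewrite H0 in Hz.
now replace (w z) with (w z - 0) by ring.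
Qed.

Lemma near0_neq (f : C -> C) (l : C) :
  is_Cderive f 0 l -> f 0 <> 0 -> near0 (fun z => f z <> 0).
Proof.
intros H H0.
apply (near0_imp (fun z => (Cmod (f z - f 0%C) < Cmod (f 0%C))%R)).
- intros z Hz E; rewrite E in Hz.
  replace (0 - f 0) with (- f 0) in Hz by ring; rewrite Cmod_opp in Hz; lra.
- apply (is_Cderive_near0 f l); trivial; now apply Cmod_gt_0.
Qed.

Lemma near0_bounded (f : C -> C) (l : C) :
  is_Cderive f 0 l -> exists K, near0 (fun z => (Cmod (f z) <= K)%R).
Proof.
intros H.
exists (Cmod (f 0%C) + 1)%R.
apply (near0_imp (fun z => (Cmod (f z - f 0%C) < 1)%R)).
- intros z Hz.
  pose proof (Cmod_triangle (f 0) (f z - f 0)) as Ht.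
  replace (f 0 + (f z - f 0)) with (f z) in Ht by ring; lra.
- apply (is_Cderive_near0 f l); trivial; lra.
Qed.

(** The Taylor remainder is exactly [(y - z)^2 / (y z^2)], and [|y| > |z| / 2] on the disc of radius
    [|z| / 2] about [z]. *)
Lemma is_Cderive_inv (z : C) : z <> 0 -> is_Cderive (fun x => / x) z (- / z ^ 2).
Proof.
intros Hz.
pose proof (proj1 (Cmod_gt_0 z) Hz) as Hp.
apply is_Cderive_quadratic with (K := (2 / Cmod z ^ 3)%R) (d := (Cmod z / 2)%R); [lra|].
intros y Hy.
assert (Hyz : (Cmod z / 2 < Cmod y)%R).
{ pose proof (Cmod_triangle y (- (y - z))) as Ht; rewrite Cmod_opp in Ht.
  replace (y + - (y - z)) with z in Ht by ring; lra. }
assert (Hy0 : y <> 0) by (apply Cmod_gt_0; lra).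
replace (/ y - / z - (y - z) * - / z ^ 2) with ((y - z) ^ 2 * / (y * z ^ 2))
  by (field; now split).
rewrite Cmod_mult, Cmod_inv, Cmod_mult, !Cmod_pow by
  (apply Cmult_neq_0; trivial; now apply Cpow_nz).
rewrite (Rmult_comm (2 / _)).
apply Rmult_le_compat_l; [apply pow2_ge_0|].
apply Rle_trans with (/ (Cmod z / 2 * Cmod z ^ 2))%R.
- assert (0 < Cmod z ^ 2)%R by (apply pow_lt; lra).
  apply Rinv_le_contravar; [|apply Rmult_le_compat_r]; nra.
- right; field; lra.
Qed.

Lemma is_Cderive_div (f g : C -> C) (z l m : C) :
  g z <> 0 -> is_Cderive f z l -> is_Cderive g z m ->
  is_Cderive (fun x => f x / g x) z ((l * g z - f z * m) / g z ^ 2).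
Proof.
intros Hz Hf Hg.
eapply is_Cderive_eq; [apply (is_Cderive_mult f (fun x => / g x) z); [exact Hf|]|].
- apply (is_Cderive_comp Cinv g); [now apply is_Cderive_inv|exact Hg].
- cbv beta; field; exact Hz.
Qed.

(** * Uniqueness for linear equations, along segments from [0] *)

(** Restriction to a ray turns complex derivatives into real ones, to which the real mean value
    theorem applies. *)
Lemma is_Cderive_ray (f : C -> C) (z l : C) (t : R) :
  is_Cderive f (t * z) l -> is_derive (fun s : R => Re (f (s * z))) t (Re (z * l))
    /\ is_derive (fun s : R => Im (f (s * z))) t (Im (z * l)).
Proof.
intros H.
pose proof (Cmod_ge_0 z) as Hz0.
(* One argument serves every real-linear [p] of norm at most [1]; [Re] and [Im] are the two
   instances. *)
assert (Hgen : forall p : C -> R,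
  (forall u v : C, p (u - v)%C = p u - p v)%R ->
  (forall (x : R) (u : C), p (x * u)%C = x * p u)%R ->
  (forall u, Rabs (p u) <= Cmod u)%R ->
  is_derive (fun s : R => p (f (s * z)%C)) t (p (z * l))).
{ intros p Hp1 Hp2 Hp3.
  split; [apply is_linear_scal_l|].
  intros x Hx eps.
  apply (@is_filter_lim_locally_unique R_AbsRing R_NormedModule) in Hx; subst x.
  assert (Hc : (0 < Cmod z + 1)%R) by lra.
  destruct (is_Cderive_eps _ _ _ H (mkposreal _ (Rdiv_lt_0_compat _ _ (cond_pos eps) Hc)))
    as [d [Hd Hb]]; simpl in Hb.
  exists (mkposreal _ (Rdiv_lt_0_compat _ _ Hd Hc)); intros s Hs; change R in s.
  change (Rabs (s - t) < d / (Cmod z + 1))%R in Hs.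
  change (Rabs (p (f (RtoC s * z)%C) - p (f (t * z)%C) - (s - t) * p (z * l)%C) <= eps * Rabs (s - t))%R.
  rewrite <- Hp2, <- !Hp1.
  eapply Rle_trans; [apply Hp3|].
  assert (E : Cmod (s * z - t * z) = (Rabs (s - t) * Cmod z)%R).
  { replace (s * z - t * z) with (RtoC (s - t) * z) by (rewrite RtoC_minus; ring).
    now rewrite Cmod_mult, Cmod_R. }
  replace (f (s * z) - f (t * z) - RtoC (s - t) * (z * l))
    with (f (s * z) - f (t * z) - (s * z - t * z) * l)
    by (rewrite RtoC_minus; ring).
  apply Rlt_div_r in Hs; [|exact Hc].
  pose proof (Rabs_pos (s - t)).
  eapply Rle_trans; [apply Hb; rewrite E; nra|].
  rewrite E.
  apply Rle_trans with (eps / (Cmod z + 1) * (Rabs (s - t) * (Cmod z + 1)))%R.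
  - apply Rmult_le_compat_l; [|nra].
    apply Rlt_le, Rdiv_lt_0_compat; trivial; apply cond_pos.
  - right; field; lra. }
split; apply Hgen; intros.
- reflexivity.
- apply re_scal_l.
- apply re_le_Cmod.
- reflexivity.
- apply im_scal_l.
- eapply Rle_trans; [|apply Rmax_Cmod]. apply Rmax_r.
Qed.


(* Grönwall's argument for [|U|^2] along the segment from [0] to [z]. *)
Lemma ray_zero (U c : C -> C) (z : C) (K : R) :
  (forall t : R, (0 <= t <= 1)%R -> exists l, is_Cderive U (t * z) l) ->
  (forall t : R, (0 < t <= 1)%R -> is_Cderive U (t * z) (c (t * z) * U (t * z))
     /\ (Cmod (c (t * z)%C) <= K)%R) ->
  U 0 = 0 -> U z = 0.
Proof.
intros Hex Hd H0.
(* Since the derivative of [|u|^2] is [2 Re (conj u * z c u)], at most [2 K |z| |u|^2], this rate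
   makes [v = |u|^2 exp (- k t)] nonincreasing. *)
set (k := (2 * K * Cmod z)%R).
set (u := fun t : R => U (t * z)).
set (v := fun t : R => ((Re (u t) ^ 2 + Im (u t) ^ 2) * exp (- k * t))%R).
set (dv := fun (t : R) (l : C) =>
  ((2 * Re (u t) * Re (z * l) + 2 * Im (u t) * Im (z * l))
   * exp (- k * t) - k * v t)%R).
assert (Hder : forall (t : R) l, is_Cderive U (t * z) l -> is_derive v t (dv t l)).
{ intros t l Hl; destruct (is_Cderive_ray _ _ _ _ Hl) as [Hr Hi].
  unfold v.
  evar_last.
  - apply Derive.is_derive_mult.
    + apply (@is_derive_plus R_AbsRing R_NormedModule);
      apply is_derive_pow; [exact Hr|exact Hi].
    + apply (is_derive_comp exp (fun x => - k * x)%R); [apply is_derive_exp|].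
      apply is_derive_scal, is_derive_id.
  - unfold dv, v, u, plus, scal, one; simpl; unfold mult; simpl; ring. }
destruct (MVT_gen v 0 1 (fun t => dv t (c (t * z) * u t))) as [t [Ht E]].
- rewrite Rmin_left, Rmax_right by lra; intros t Ht.
  apply Hder, Hd; lra.
- rewrite Rmin_left, Rmax_right by lra; intros t Ht.
  destruct (Hex t Ht) as [l Hl].
  apply continuity_pt_filterlim, (@ex_derive_continuous R_AbsRing R_NormedModule).
  eexists; apply Hder, Hl.
- rewrite Rmin_left, Rmax_right in Ht by lra.
  assert (Hu0 : u 0%R = 0) by (unfold u; rewrite Cmult_0_l; exact H0).
  assert (Hv0 : v 0%R = 0%R) by (unfold v; rewrite Hu0; simpl; ring).
  assert (Hle : (dv t (c (t * z)%C * u t)%C <= 0)%R).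
  { destruct (Req_dec t 0) as [->|Ht0].
    (* The mean value point may be [0], where no equation is assumed; there [dv] vanishes because
       [u 0 = 0]. *)
    - unfold dv; rewrite Hv0, Hu0; simpl; right; ring.
    - destruct (Hd t) as [_ Hc]; [lra|].
      set (e := exp (- k * t)).
      assert (He : (0 < e)%R) by apply exp_pos.
      set (w := z * (c (t * z) * u t)).
      replace (dv t (c (t * z) * u t)) with
        (2 * (Re (Cconj (u t) * w) - K * Cmod z * Cmod (u t) ^ 2) * e)%R.
      2:{ unfold dv, v; fold w; fold e.
          rewrite Cmod2_alt, re_mult, re_conj, im_conj; unfold k; ring. }
      assert (Hw : (Re (Cconj (u t) * w) <= K * Cmod z * Cmod (u t) ^ 2)%R).
      { eapply Rle_trans; [apply Rle_abs|].
        eapply Rle_trans; [apply re_le_Cmod|].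
        unfold w; rewrite !Cmod_mult, Cmod_conj.
        pose proof (Cmod_ge_0 z); pose proof (Cmod_ge_0 (u t)).
        assert (0 <= Cmod z * Cmod (u t) ^ 2)%R by nra.
        nra. }
      nra. }
  assert (Hv1 : (v 1%R <= 0)%R) by lra.
  unfold v in Hv1.
  rewrite <- Cmod2_alt in Hv1.
  pose proof (exp_pos (- k * 1)).
  assert (Hm : (Cmod (u 1%R) ^ 2 <= 0)%R) by nra.
  replace z with (1 * z) by ring.
  apply Cmod_eq_0; fold (u 1%R).
  pose proof (Cmod_ge_0 (u 1%R)); nra.
Qed.

(* The equation is not assumed at [0]: for [U = z D] it would already say [D 0 = 0]. *)
Lemma linear_ode_zero (U c : C -> C) (K : R) :
  near0 (fun z => exists l, is_Cderive U z l) ->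
  near0 (fun z => z <> 0 -> is_Cderive U z (c z * U z)) ->
  near0 (fun z => (Cmod (c z) <= K)%R) ->
  U 0 = 0 -> near0 (fun z => U z = 0).
Proof.
intros H1 H2 H3 H0.
destruct (near0_and _ _ H1 (near0_and _ _ H2 H3)) as [d [Hd H]].
exists d; split; trivial; intros z Hz.
assert (Hs : forall t : R, (0 <= t <= 1)%R -> (Cmod (t * z) < d)%R).
{ intros t Ht; rewrite Cmod_mult, Cmod_R, Rabs_pos_eq by lra.
  pose proof (Cmod_ge_0 z); nra. }
destruct (Ceq_dec z 0) as [->|Hz0]; trivial.
apply ray_zero with (c := c) (K := K); trivial.
- intros t Ht; apply H, Hs, Ht.
- intros t Ht; destruct (H (t * z)) as [_ [Ha Hb]]; [apply Hs; lra|].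
  split; trivial; apply Ha, Cmult_neq_0; trivial.
  intros E; apply RtoC_inj in E; lra.
Qed.

(** * Complex series and termwise differentiation of power series *)

Definition csums (u : nat -> C) (l : C) : Prop :=
  @is_series C_AbsRing C_NormedModule u l.

Lemma csums_ext (u v : nat -> C) (l : C) :
  (forall n, u n = v n) -> csums u l -> csums v l.
Proof. exact (@is_series_ext C_AbsRing C_NormedModule u v l). Qed.

Lemma csums_plus (u v : nat -> C) (l m : C) :
  csums u l -> csums v m -> csums (fun n => u n + v n) (l + m).
Proof. exact (@is_series_plus C_AbsRing C_NormedModule u v l m). Qed.

Lemma csums_scal (c : C) (u : nat -> C) (l : C) :
  csums u l -> csums (fun n => c * u n) (c * l).
Proof. exact (@is_series_scal C_AbsRing C_NormedModule c u l). Qed.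

Lemma csums_unique (u : nat -> C) (l m : C) : csums u l -> csums u m -> l = m.
Proof.
intros Hl Hm.
exact (@filterlim_locally_unique _ C_AbsRing C_NormedModule _ _ _ _ _ Hl Hm).
Qed.

Lemma csums_decr_1 (u : nat -> C) (l : C) :
  csums (fun n => u (S n)) (l - u O) -> csums u l.
Proof. exact (@is_series_decr_1 C_AbsRing C_NormedModule u l). Qed.

Lemma csums_incr_1 (u : nat -> C) (l : C) :
  csums u l -> csums (fun n => u (S n)) (l - u O).
Proof.
intros H; apply (@is_series_incr_1 C_AbsRing C_NormedModule).
change (csums u (l - u O + u O)).
now replace (l - u O + u O) with l by ring.
Qed.

Lemma csums_ex (u : nat -> C) (b : nat -> R) :
  (forall n, (Cmod (u n) <= b n)%R) -> ex_series b -> exists l, csums u l.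
Proof.
intros H Hb.
exact (@ex_series_le C_AbsRing C_CompleteNormedModule u b H Hb).
Qed.

Lemma csums_norm (u : nat -> C) (b : nat -> R) (l : C) (s : R) :
  (forall n, (Cmod (u n) <= b n)%R) -> csums u l -> is_series b s ->
  (Cmod l <= s)%R.
Proof.
intros H Hu Hb.
assert (Hn : is_lim_seq (fun n => @norm C_AbsRing C_NormedModule (sum_n u n))
               (@norm C_AbsRing C_NormedModule l)).
{ apply (filterlim_comp _ _ _ (sum_n u) norm eventually (locally l) _ Hu).
  apply (@filterlim_norm C_AbsRing C_NormedModule). }
refine (is_lim_seq_le _ (sum_n b) (@norm C_AbsRing C_NormedModule l) s _ Hn Hb).
intros n.
eapply Rle_trans; [apply (@norm_sum_n_m C_AbsRing C_NormedModule)|].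
apply sum_n_m_le, H.
Qed.

(** Same body as [hypF] with arbitrary coefficients, so [hypF a b 1] is convertible to
    [cps (hyp_coef a b 1)]. *)
Definition cps (a : nat -> C) (z : C) : C :=
  iota (T := C_CompleteNormedModule) (fun l : C => is_pseries a z l).

Lemma is_pseries_csums (a : nat -> C) (z l : C) :
  @is_pseries C_AbsRing C_NormedModule a z l <-> csums (fun n => a n * z ^ n) l.
Proof.
assert (E : forall n, scal (@pow_n C_Ring z n) (a n) = a n * z ^ n).
{ intros n; exact (Cmult_comm (z ^ n) (a n)). }
split; intros H.
- exact (csums_ext _ _ _ E H).
- exact (csums_ext _ _ _ (fun n => eq_sym (E n)) H).
Qed.

Lemma cps_unique (a : nat -> C) (z l : C) :
  csums (fun n => a n * z ^ n) l -> cps a z = l.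
Proof.
intros Hl.
apply (iota_unique (V := C_CompleteNormedModule) (fun l : C => is_pseries a z l)).
- intros y Hy; apply is_pseries_csums in Hy; exact (csums_unique _ _ _ Hy Hl).
- now apply is_pseries_csums.
Qed.

(** This stands in for a radius of convergence: it gives convergence for [|z| < 1 / r], and it
    survives formal differentiation at the price of doubling [r], since [n + 1 <= 2^n]. *)
Definition geo_bounded (M r : R) (a : nat -> C) : Prop :=
  (0 < r)%R /\ forall n, (Cmod (a n) <= M * r ^ n)%R.

Lemma cps_correct (M r : R) (a : nat -> C) (z : C) :
  geo_bounded M r a -> (Cmod z < / r)%R -> csums (fun n => a n * z ^ n) (cps a z).
Proof.
intros [Hr Ha] Hz.
assert (Hq : (Cmod z * r < 1)%R).
{ apply (Rmult_lt_compat_r r) in Hz; trivial; rewrite Rinv_l in Hz; lra. }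
pose proof (Cmod_ge_0 z).
destruct (csums_ex (fun n => a n * z ^ n) (fun n => M * (Cmod z * r) ^ n)%R) as [l Hl].
- intros n; rewrite Cmod_mult, Cmod_pow, Rpow_mult_distr.
  pose proof (pow_le _ n (Cmod_ge_0 z)).
  pose proof (Rmult_le_compat_r _ _ _ H0 (Ha n)); lra.
- apply (@ex_series_scal_l R_AbsRing R_NormedModule M).
  exists (/ (1 - Cmod z * r))%R; apply is_series_geom.
  rewrite Rabs_pos_eq; trivial; nra.
- now rewrite (cps_unique _ _ _ Hl).
Qed.

Definition cps_d (a : nat -> C) (n : nat) : C := RtoC (INR (S n)) * a (S n).

Lemma INR_S_le_pow2 (n : nat) : (INR (S n) <= 2 ^ n)%R.
Proof.
induction n as [|n IH]; [simpl; lra|].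
rewrite S_INR; cbn [pow]; pose proof (pow_R1_Rle 2 n); lra.
Qed.

Lemma geo_bounded_d (M r : R) (a : nat -> C) :
  geo_bounded M r a -> geo_bounded (M * r) (2 * r) (cps_d a).
Proof.
intros [Hr Ha]; split; [lra|]; intros n.
unfold cps_d; rewrite Cmod_mult, Cmod_R, Rabs_pos_eq by apply pos_INR.
specialize (Ha (S n)); simpl in Ha.
pose proof (INR_S_le_pow2 n) as H2.
pose proof (Cmod_ge_0 (a (S n))); pose proof (pos_INR (S n)).
rewrite Rpow_mult_distr.
replace (M * r * (2 ^ n * r ^ n))%R with (2 ^ n * (M * (r * r ^ n)))%R by ring.
now apply Rmult_le_compat.
Qed.

(* From [e (n+1) = y e n + (n+1) z^n (y-z)^2], where [e n] is the quantity being bounded. *)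
Lemma pow_taylor_bound (y z : C) (r : R) (n : nat) :
  (0 < r)%R -> (Cmod y <= r)%R -> (Cmod z <= r)%R ->
  (Cmod (y ^ S n - z ^ S n - (y - z) * (RtoC (INR (S n)) * z ^ n))
    <= Cmod (y - z) ^ 2 * (2 * r) ^ n / r)%R.
Proof.
intros Hr Hy Hz.
induction n as [|n IH].
- replace (y ^ 1 - z ^ 1 - (y - z) * (RtoC (INR 1) * z ^ 0)) with (RtoC 0)
    by (simpl; ring).
  rewrite Cmod_0; apply Rle_div_r; trivial; simpl.
  pose proof (Cmod_ge_0 (y - z)); nra.
- set (e := y ^ S n - z ^ S n - (y - z) * (RtoC (INR (S n)) * z ^ n)) in IH.
  replace (_ - _) with (y * e + (y - z) ^ 2 * (RtoC (INR (S n)) * z ^ n)).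
  2:{ unfold e; rewrite (S_INR (S n)), RtoC_plus; cbn [Cpow]; ring. }
  eapply Rle_trans; [apply Cmod_triangle|].
  rewrite !Cmod_mult, !Cmod_pow, Cmod_R, Rabs_pos_eq by apply pos_INR.
  set (h := (Cmod (y - z) ^ 2)%R) in *.
  assert (Hh : (0 <= h)%R) by apply pow2_ge_0.
  pose proof (INR_S_le_pow2 n) as H2.
  assert (Hzn : (Cmod z ^ n <= r ^ n)%R)
    by (apply pow_incr; split; [apply Cmod_ge_0|trivial]).
  pose proof (Cmod_ge_0 e); pose proof (Cmod_ge_0 y); pose proof (pos_INR (S n)).
  pose proof (pow_le _ n (Cmod_ge_0 z)).
  replace (h * (2 * r) ^ S n / r)%R
    with (r * (h * (2 * r) ^ n / r) + h * (2 ^ n * r ^ n))%R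
    by (rewrite !Rpow_mult_distr; simpl; field; lra).
  apply Rplus_le_compat; [now apply Rmult_le_compat|].
  apply Rmult_le_compat_l; trivial; now apply Rmult_le_compat.
Qed.

(** The Taylor remainders of the monomials are summed. With [s = 1 / (4 r)] the bound [(2 s)^n]
    against [r^n] leaves a geometric series of ratio [1/2], hence a remainder quadratic in
    [y - z]. *)
Lemma cps_derive (M r : R) (a : nat -> C) (z : C) :
  geo_bounded M r a -> (Cmod z < / (4 * r))%R -> is_Cderive (cps a) z (cps (cps_d a) z).
Proof.
intros Hg Hz; pose proof Hg as [Hr Ha].
set (s := (/ (4 * r))%R) in *.
assert (Hs : (0 < s)%R) by (apply Rinv_0_lt_compat; lra).
assert (Hs1 : (s < / r)%R) by (apply Rinv_lt_contravar; nra).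
assert (Hs2 : (s < / (2 * r))%R) by (apply Rinv_lt_contravar; nra).
apply is_Cderive_quadratic with (K := (2 * (M * r / s))%R) (d := (s - Cmod z)%R); [lra|].
intros y Hy.
assert (Hys : (Cmod y < s)%R).
{ pose proof (Cmod_triangle z (y - z)) as Ht.
  replace (z + (y - z)) with y in Ht by ring; lra. }
pose proof (csums_incr_1 _ _ (cps_correct M r a y Hg (Rlt_trans _ _ _ Hys Hs1))) as Sy.
pose proof (csums_incr_1 _ _ (cps_correct M r a z Hg (Rlt_trans _ _ _ Hz Hs1))) as Sz.
pose proof (cps_correct _ _ _ z (geo_bounded_d _ _ _ Hg) (Rlt_trans _ _ _ Hz Hs2)) as Sd.
pose proof (csums_plus _ _ _ _ Sy (csums_plus _ _ _ _ (csums_scal (- (1)) _ _ Sz)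
  (csums_scal (- (y - z)) _ _ Sd))) as S1.
replace (cps a y - cps a z - (y - z) * cps (cps_d a) z) with
  (cps a y - a O * y ^ 0 + (- (1) * (cps a z - a O * z ^ 0)
     + - (y - z) * cps (cps_d a) z)) by (simpl; ring).
replace (2 * (M * r / s) * Cmod (y - z) ^ 2)%R
  with ((M * r / s * Cmod (y - z) ^ 2) * / (1 - / 2))%R by (field; lra).
refine (csums_norm _ _ _ _ _ S1 (is_series_scal_l
  (M * r / s * Cmod (y - z) ^ 2)%R _ _ (is_series_geom (/ 2) _))).
2:{ rewrite Rabs_pos_eq; lra. }
intros n; unfold cps_d.
replace (_ + _) with
  (a (S n) * (y ^ S n - z ^ S n - (y - z) * (RtoC (INR (S n)) * z ^ n))) by ring.
rewrite Cmod_mult.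
pose proof (pow_taylor_bound y z s n Hs (Rlt_le _ _ Hys) (Rlt_le _ _ Hz)) as HT.
pose proof (Rmult_le_compat _ _ _ _ (Cmod_ge_0 _) (Cmod_ge_0 _) (Ha (S n)) HT) as HB.
eapply Rle_trans; [exact HB|right].
replace (2 * s)%R with (/ 2 * / r)%R by (unfold s; field; lra).
change (scal ?x ?y) with (x * y)%R.
rewrite Rpow_mult_distr, (pow_inv r); simpl; field.
split; [lra|]; apply pow_nonzero; lra.
Qed.

(** The Euler operator [z d/dz] multiplies the coefficient of [z^n] by [n]. *)
Lemma csums_index (a : nat -> C) (z l : C) :
  csums (fun n => cps_d a n * z ^ n) l ->
  csums (fun n => RtoC (INR n) * a n * z ^ n) (z * l).
Proof.
intros H; apply csums_decr_1.
replace (z * l - RtoC (INR 0) * a O * z ^ 0) with (z * l) by (simpl; ring).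
apply (csums_scal z) in H; revert H.
apply csums_ext; intros n; unfold cps_d; cbn [Cpow]; ring.
Qed.

(** * The hypergeometric coefficients and the differential equation *)

Lemma poch_1_neq_0 (n : nat) : poch 1 n <> 0.
Proof.
induction n as [|n IH]; [apply C1_nz|].
apply Cmult_neq_0; trivial.
rewrite <- RtoC_plus; intros E; apply RtoC_inj in E.
pose proof (pos_INR n); lra.
Qed.

Lemma hyp_coef_S (a b : C) (n : nat) :
  RtoC (INR (S n)) ^ 2 * hyp_coef a b 1 (S n)
  = (a + RtoC (INR n)) * (b + RtoC (INR n)) * hyp_coef a b 1 n.
Proof.
assert (Hn : 1 + RtoC (INR n) <> 0).
{ rewrite <- RtoC_plus; intros E; apply RtoC_inj in E.
  pose proof (pos_INR n); lra. }
unfold hyp_coef; cbn [poch]; rewrite S_INR, RtoC_plus.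
field; split; trivial; apply poch_1_neq_0.
Qed.

(** From [|a + n| <= (n + 1) (1 + |a|)], the ratio of consecutive coefficients is at most
    [(1 + |a|) (1 + |b|)]. This crude rate suffices for statements near [0]. *)
Lemma hyp_coef_bounded (a b : C) :
  geo_bounded 1 ((1 + Cmod a) * (1 + Cmod b)) (hyp_coef a b 1).
Proof.
pose proof (Cmod_ge_0 a) as Ha; pose proof (Cmod_ge_0 b) as Hb.
split; [nra|]; induction n as [|n IH].
- unfold hyp_coef; simpl.
  replace (1 * 1 / (1 * 1)) with (RtoC 1) by (field; apply C1_nz).
  rewrite Cmod_1; lra.
- pose proof (pos_INR n) as Hn.
  assert (Hfac : forall c, (Cmod (c + RtoC (INR n)) <= INR (S n) * (1 + Cmod c))%R).
  { intros c; eapply Rle_trans; [apply Cmod_triangle|].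
    rewrite Cmod_R, Rabs_pos_eq, S_INR by trivial.
    pose proof (Cmod_ge_0 c); nra. }
  assert (Hs : (0 < INR (S n))%R) by (rewrite S_INR; lra).
  apply Rmult_le_reg_l with (INR (S n) ^ 2)%R; [now apply pow_lt|].
  pose proof (f_equal Cmod (hyp_coef_S a b n)) as E.
  rewrite !Cmod_mult, Cmod_pow, Cmod_R, Rabs_pos_eq in E by lra.
  rewrite E.
  replace (INR (S n) ^ 2 * (1 * ((1 + Cmod a) * (1 + Cmod b)) ^ S n))%R with
    (INR (S n) * (1 + Cmod a) * (INR (S n) * (1 + Cmod b))
      * (1 * ((1 + Cmod a) * (1 + Cmod b)) ^ n))%R by (simpl; ring).
  apply Rmult_le_compat; trivial; try apply Cmod_ge_0.
  { rewrite <- Cmod_mult; apply Cmod_ge_0. }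
  apply Rmult_le_compat; trivial; apply Cmod_ge_0.
Qed.

Lemma hypF_ode (a b : C) : exists f1 f2 : C -> C, near0 (fun z =>
  is_Cderive (hypF a b 1) z (f1 z) /\ is_Cderive f1 z (f2 z) /\
  z * (1 - z) * f2 z + (1 - (a + b + 1) * z) * f1 z - a * b * hypF a b 1 z = 0).
Proof.
set (u := hyp_coef a b 1).
pose proof (hyp_coef_bounded a b) as G0; fold u in G0.
pose proof (geo_bounded_d _ _ _ G0) as G1.
pose proof (geo_bounded_d _ _ _ G1) as G2.
set (r := ((1 + Cmod a) * (1 + Cmod b))%R) in *.
destruct G0 as [Hr G0']; pose proof (conj Hr G0') as G0; fold (geo_bounded 1 r u) in G0.
exists (cps (cps_d u)), (cps (cps_d (cps_d u))).
(* [cps_derive] is also applied to [cps_d u], whose growth rate is [2 * r]. *)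
exists (/ (4 * (2 * r)))%R; split; [apply Rinv_0_lt_compat; lra|].
intros z Hz.
assert (Hlt : forall t, (0 < t)%R -> (t <= 8 * r)%R -> (Cmod z < / t)%R).
{ intros t Ht Htr; eapply Rlt_le_trans; [exact Hz|].
  apply Rinv_le_contravar; lra. }
split; [|split].
- apply (cps_derive 1 r); trivial; apply Hlt; lra.
- apply (cps_derive _ _ _ _ G1); apply Hlt; lra.
- change (hypF a b 1 z) with (cps u z).
  pose proof (cps_correct _ _ _ z G0 (Hlt _ Hr ltac:(lra))) as S0.
  pose proof (cps_correct _ _ _ z G1 (Hlt (2 * r)%R ltac:(lra) ltac:(lra))) as S1.
  pose proof (cps_correct _ _ _ z G2 (Hlt (2 * (2 * r))%R ltac:(lra) ltac:(lra))) as S2.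
  pose proof (csums_index _ _ _ S1) as T1.
  pose proof (csums_index _ _ _ S2) as T2.
  (* With this shift [n v_n = n (n - 1) u_n] are the coefficients of [z^2 F'']. *)
  set (v := fun n => RtoC (INR n - 1) * u n).
  assert (T3 : csums (fun n => RtoC (INR n) * v n * z ^ n)
     (z * (z * cps (cps_d (cps_d u)) z))).
  { apply csums_index; revert T2; apply csums_ext; intros n.
    unfold v, cps_d; rewrite S_INR, RtoC_minus, RtoC_plus; ring. }
  (* The left side of the equation is the sum of a series whose terms vanish by the coefficient
     recursion; the zero series is written as [0] times a convergent one. *)
  apply (csums_unique (fun n => 0 * (u n * z ^ n))).
  + pose proof (csums_plus _ _ _ _ T2 (csums_plus _ _ _ _ (csums_scal (- (1)) _ _ T3)
      (csums_plus _ _ _ _ S1 (csums_plus _ _ _ _ (csums_scal (- (a + b + 1)) _ _ T1)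
        (csums_scal (- (a * b)) _ _ S0))))) as T.
    replace (z * (1 - z) * cps (cps_d (cps_d u)) z +
      (1 - (a + b + 1) * z) * cps (cps_d u) z - a * b * cps u z) with
     (z * cps (cps_d (cps_d u)) z +
      (- (1) * (z * (z * cps (cps_d (cps_d u)) z)) +
       (cps (cps_d u) z +
        (- (a + b + 1) * (z * cps (cps_d u) z) + - (a * b) * cps u z)))) by ring.
    revert T; apply csums_ext; intros n.
    transitivity (z ^ n * (RtoC (INR (S n)) ^ 2 * u (S n)
      - (a + RtoC (INR n)) * (b + RtoC (INR n)) * u n)).
    * unfold v, cps_d; rewrite S_INR, RtoC_minus, RtoC_plus; ring.
    * unfold u; rewrite hyp_coef_S; ring.
  + apply (csums_scal 0) in S0; now rewrite Cmult_0_l in S0.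
Qed.

Lemma hypF_0 (a b : C) : hypF a b 1 0 = 1.
Proof.
destruct (hyp_coef_bounded a b) as [Hr Hb].
apply (cps_unique (hyp_coef a b 1)), csums_decr_1.
pose proof (csums_incr_1 _ _ (cps_correct _ _ _ 0 (conj Hr Hb)
  ltac:(rewrite Cmod_0; now apply Rinv_0_lt_compat))) as H.
apply (csums_scal 0) in H; rewrite Cmult_0_l in H.
replace (1 - hyp_coef a b 1 O * 0 ^ 0) with (RtoC 0)
  by (unfold hyp_coef; simpl; field; apply C1_nz).
revert H; apply csums_ext; intros n; cbn [Cpow]; ring.
Qed.

(** * Regular Riccati solutions and pullback of the logarithmic derivative *)

(** By continuity, [f 0 <> 0] would keep [f] away from [0] at nearby nonzero points. *)
Lemma near0_punctured (f : C -> C) (l : C) :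
  is_Cderive f 0 l -> near0 (fun z => z <> 0 -> f z = 0) -> near0 (fun z => f z = 0).
Proof.
intros Hf H.
assert (H0 : f 0 = 0).
{ destruct (Ceq_dec (f 0) 0) as [E|Hn]; trivial.
  destruct (near0_and _ _ H (near0_neq f l Hf Hn)) as [d [Hd Hz]].
  destruct (Hz (RtoC (d / 2))) as [Ha Hb].
  - rewrite Cmod_R, Rabs_pos_eq; lra.
  - exfalso; apply Hb, Ha; intros E; apply RtoC_inj in E; lra. }
revert H; apply near0_imp; intros z Hz.
destruct (Ceq_dec z 0) as [->|Hn]; auto.
Qed.

Lemma Cmult_integral_0 (x y : C) : x * y = 0 -> x <> 0 -> y = 0.
Proof.
intros H Hx.
replace y with (/ x * (x * y)) by (field; trivial).
rewrite H; ring.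
Qed.

Definition hyp_riccati (a b : C) (f : C -> C) : Prop :=
  near0 (fun z => exists l, is_Cderive f z l /\
    z * (1 - z) * (l + f z ^ 2) + (1 - (a + b + 1) * z) * f z - a * b = 0).

(* The last two hypotheses, with denominators cleared, say that [f (w z) * w1 z]
   and [g z + lam z] satisfy the same Riccati equation. *)
Lemma riccati_unique (a b c d : C) (f g w w1 w2 lam lam1 : C -> C) :
  hyp_riccati a b f -> hyp_riccati c d g ->
  near0 (fun z => is_Cderive w z (w1 z)) ->
  near0 (fun z => is_Cderive w1 z (w2 z)) ->
  near0 (fun z => is_Cderive lam z (lam1 z)) ->
  w 0 = 0 ->
  near0 (fun z => z <> 0 -> w z <> 0) ->
  near0 (fun z =>
    z * (1 - z) * (w z * (1 - w z) * (w2 z - 2 * lam z * w1 z)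
                   - (1 - (a + b + 1) * w z) * w1 z ^ 2)
    + (1 - (c + d + 1) * z) * (w1 z * w z * (1 - w z)) = 0) ->
  near0 (fun z =>
    z * (1 - z) * (a * b) * w1 z ^ 2 =
    w z * (1 - w z) * (c * d + z * (1 - z) * (lam1 z - lam z ^ 2)
                       + (1 - (c + d + 1) * z) * lam z)) ->
  near0 (fun z => f (w z) * w1 z = g z + lam z).
Proof.
intros Hf Hg Hw Hw1 Hlam w0 Hwn E1 E2.
assert (Hfw := near0_comp w _ _ (near0_center _ Hw) w0 Hf).
assert (Hz1 : near0 (fun z => 1 - z <> 0)).
{ apply (near0_neq (fun z => 1 - z) (0 - 1)).
  - apply is_Cderive_minus; [apply is_Cderive_const|apply is_Cderive_id].
  - replace (1 - 0) with (RtoC 1) by ring; apply C1_nz. }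
assert (Hwz1 := near0_comp w _ _ (near0_center _ Hw) w0 Hz1).
set (m := fun z => f (w z) * w1 z).
set (n := fun z => g z + lam z).
set (U := fun z => z * (m z - n z)).
(* Subtracting the Riccati equations gives [(m - n)' = - (p + m + n) (m - n)] with [p = (1 - (c + d
   + 1) z) / (z (1 - z)) - 2 lam]. The factor [z] of [U] contributes [1 / z], which cancels the pole
   of [p] and leaves [(c + d) / (1 - z)]. *)
set (k := fun z => (c + d) / (1 - z) + 2 * lam z - (m z + n z)).
assert (Hm : near0 (fun z => exists l, is_Cderive f (w z) l /\
   is_Cderive m z (w1 z * l * w1 z + f (w z) * w2 z) /\
   w z * (1 - w z) * (l + f (w z) ^ 2) + (1 - (a + b + 1) * w z) * f (w z) - a * b = 0)).
{ generalize (near0_and _ _ Hfw (near0_and _ _ Hw Hw1)).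
  apply near0_imp; intros z [[l [Hl El]] [Hwz Hw1z]].
  exists l; split; [trivial|split; [|trivial]].
  apply (is_Cderive_mult (fun z => f (w z)) w1); trivial.
  now apply is_Cderive_comp. }
assert (Hn : near0 (fun z => exists l, is_Cderive n z (l + lam1 z) /\
   z * (1 - z) * (l + g z ^ 2) + (1 - (c + d + 1) * z) * g z - c * d = 0)).
{ generalize (near0_and _ _ Hg Hlam).
  apply near0_imp; intros z [[l [Hl El]] Hlz].
  exists l; split; [now apply is_Cderive_plus|trivial]. }
assert (HU : near0 (fun z => exists l, is_Cderive U z l)).
{ generalize (near0_and _ _ Hm Hn).
  apply near0_imp; intros z [[l [_ [Hl _]]] [l' [Hl' _]]].
  eexists; apply is_Cderive_mult; [apply is_Cderive_id|apply is_Cderive_minus; eassumption]. }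
assert (HUk : near0 (fun z => z <> 0 -> is_Cderive U z (k z * U z))).
{ generalize (near0_and _ _ Hm (near0_and _ _ Hn (near0_and _ _ Hwn
    (near0_and _ _ Hz1 (near0_and _ _ Hwz1 (near0_and _ _ E1 E2)))))).
  apply near0_imp.
  intros z [[l [_ [Hl El]]] [[l' [Hl' El']] [Hwnz [Hz [Hwz [Ez1 Ez2]]]]]] Hz0.
  specialize (Hwnz Hz0).
  eapply is_Cderive_eq.
  - apply is_Cderive_mult; [apply is_Cderive_id|apply is_Cderive_minus; eassumption].
  - unfold U, k, m, n.
    set (W := w z) in *; set (W1 := w1 z) in *; set (W2 := w2 z) in *.
    set (L := lam z) in *; set (L1 := lam1 z) in *.
    set (F := f W) in *; set (G := g z) in *.
    apply Ceq_minus.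
    apply (fun H => Cmult_integral_0 ((1 - z) * (W * (1 - W))) _ H
             (Cmult_neq_0 _ _ Hz (Cmult_neq_0 _ _ Hwnz Hwz))).
    apply Ceq_minus in Ez2.
    (* After multiplication by [(1 - z) W (1 - W)], the claim is a combination of the two Riccati
       equations and the two compatibility hypotheses. *)
    transitivity (
      z * (1 - z) * W1 ^ 2 * (W * (1 - W) * (l + F ^ 2) + (1 - (a + b + 1) * W) * F - a * b)
      - W * (1 - W) * (z * (1 - z) * (l' + G ^ 2) + (1 - (c + d + 1) * z) * G - c * d)
      + F * (z * (1 - z) * (W * (1 - W) * (W2 - 2 * L * W1) - (1 - (a + b + 1) * W) * W1 ^ 2)
              + (1 - (c + d + 1) * z) * (W1 * W * (1 - W)))
      + (z * (1 - z) * (a * b) * W1 ^ 2 -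
         W * (1 - W) * (c * d + z * (1 - z) * (L1 - L ^ 2) + (1 - (c + d + 1) * z) * L))).
    + field; trivial.
    + rewrite El, El', Ez1, Ez2; ring. }
assert (Hk : exists l, is_Cderive k 0 l).
{ destruct (near0_center _ Hm) as [l [_ [Hl _]]].
  destruct (near0_center _ Hn) as [l' [Hl' _]].
  pose proof (near0_center _ Hlam) as Hl0; cbv beta in Hl0.
  eexists; apply is_Cderive_minus; [apply is_Cderive_plus|apply is_Cderive_plus; eassumption].
  - apply is_Cderive_div; [exact (near0_center _ Hz1)|apply is_Cderive_const|].
    apply is_Cderive_minus; [apply is_Cderive_const|apply is_Cderive_id].
  - apply is_Cderive_mult; [apply is_Cderive_const|exact Hl0]. }
destruct Hk as [l Hk].
destruct (near0_bounded _ _ Hk) as [K HK].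
assert (HU0 : near0 (fun z => U z = 0)).
{ apply linear_ode_zero with k K; trivial. unfold U; ring. }
assert (Hmn : near0 (fun z => z <> 0 -> m z = n z)).
{ revert HU0; apply near0_imp; intros z Hz Hz0.
  apply Ceq_minus; exact (Cmult_integral_0 _ _ Hz Hz0). }
(* Dividing [U] by [z] settles only [z <> 0]; continuity adds the centre. *)
apply (near0_imp (fun z => m z - n z = 0)); [intros z; apply Ceq_minus|].
destruct (near0_center _ Hm) as [l' [_ [Hl' _]]].
destruct (near0_center _ Hn) as [l'' [Hl'' _]].
apply (near0_punctured (fun z => m z - n z) _ (is_Cderive_minus _ _ _ _ _ Hl' Hl'')).
revert Hmn; apply near0_imp; intros z Hz Hz0; now apply -> Ceq_minus; apply Hz.
Qed.

Definition hyp_logder (a b : C) (f : C -> C) : Prop :=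
  hyp_riccati a b f /\
  near0 (fun z => is_Cderive (hypF a b 1) z (f z * hypF a b 1 z)).

Lemma hyp_logder_ex (a b : C) : exists f, hyp_logder a b f.
Proof.
destruct (hypF_ode a b) as [f1 [f2 H]].
assert (HF : near0 (fun z => hypF a b 1 z <> 0)).
{ apply (near0_neq _ _ (proj1 (near0_center _ H))).
  rewrite hypF_0; apply C1_nz. }
exists (fun z => f1 z / hypF a b 1 z); split;
  generalize (near0_and _ _ H HF); apply near0_imp;
  intros z [[H1 [H2 E]] Hz].
- eexists; split; [apply is_Cderive_div; eassumption|].
  transitivity ((z * (1 - z) * f2 z + (1 - (a + b + 1) * z) * f1 z
                  - a * b * hypF a b 1 z) / hypF a b 1 z).
  + field; trivial.
  + rewrite E; field; trivial.
- apply (is_Cderive_eq _ _ _ _ H1); field; trivial.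
Qed.

(** By the chain rule [hypF a b 1 (w z)] has logarithmic derivative [f (w z) * w1 z], which
    [riccati_unique] identifies with [g z + lam z]. *)
Lemma hyp_pullback (a b c d : C) (g w w1 w2 lam lam1 : C -> C) :
  hyp_logder c d g ->
  near0 (fun z => is_Cderive w z (w1 z)) ->
  near0 (fun z => is_Cderive w1 z (w2 z)) ->
  near0 (fun z => is_Cderive lam z (lam1 z)) ->
  w 0 = 0 ->
  near0 (fun z => z <> 0 -> w z <> 0) ->
  near0 (fun z =>
    z * (1 - z) * (w z * (1 - w z) * (w2 z - 2 * lam z * w1 z)
                   - (1 - (a + b + 1) * w z) * w1 z ^ 2)
    + (1 - (c + d + 1) * z) * (w1 z * w z * (1 - w z)) = 0) ->
  near0 (fun z =>
    z * (1 - z) * (a * b) * w1 z ^ 2 =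
    w z * (1 - w z) * (c * d + z * (1 - z) * (lam1 z - lam z ^ 2)
                       + (1 - (c + d + 1) * z) * lam z)) ->
  near0 (fun z => is_Cderive (fun x => hypF a b 1 (w x)) z
                     ((g z + lam z) * hypF a b 1 (w z))).
Proof.
intros [Hg _] Hw Hw1 Hlam w0 Hwn E1 E2.
destruct (hyp_logder_ex a b) as [f [Hf HF]].
pose proof (riccati_unique a b c d f g w w1 w2 lam lam1 Hf Hg Hw Hw1 Hlam w0 Hwn E1 E2) as Hm.
pose proof (near0_comp w _ _ (near0_center _ Hw) w0 HF) as HFw.
generalize (near0_and _ _ Hm (near0_and _ _ HFw Hw)); apply near0_imp.
intros z [Em [HFz Hwz]].
eapply is_Cderive_eq; [apply (is_Cderive_comp (hypF a b 1) w); eassumption|].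
rewrite <- Em; ring.
Qed.

(** * Equality from a common logarithmic derivative; explicit differentiation *)

(** Used with [T] the difference of the two sides of an identity: both have logarithmic derivative
    [k] and they agree at [0]. *)
Lemma Cderive_linear_zero (T k : C -> C) (l : C) :
  near0 (fun z => is_Cderive T z (k z * T z)) -> is_Cderive k 0 l -> T 0 = 0 ->
  near0 (fun z => T z = 0).
Proof.
intros HT Hk T0.
destruct (near0_bounded _ _ Hk) as [K HK].
apply linear_ode_zero with k K; trivial; revert HT; apply near0_imp; eauto.
Qed.

(* Unification leaves [fun x => c * x] in the eta-reduced form [Cmult c]. *)
Ltac derive_C :=
  lazymatch goal with
  | |- is_Cderive (fun x => x) _ _ => apply is_Cderive_id
  | |- is_Cderive (fun _ => ?c) _ _ => apply is_Cderive_const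
  | |- is_Cderive (Cmult ?c) _ _ => apply (is_Cderive_mult (fun _ => c) (fun x => x)); derive_C
  | |- is_Cderive (Cminus ?c) _ _ => apply (is_Cderive_minus (fun _ => c) (fun x => x)); derive_C
  | |- is_Cderive (Cplus ?c) _ _ => apply (is_Cderive_plus (fun _ => c) (fun x => x)); derive_C
  | |- is_Cderive (fun x => _ + _) _ _ => apply is_Cderive_plus; derive_C
  | |- is_Cderive (fun x => _ - _) _ _ => apply is_Cderive_minus; derive_C
  | |- is_Cderive (fun x => - _) _ _ => apply is_Cderive_opp; derive_C
  | |- is_Cderive (fun x => _ * _) _ _ => apply is_Cderive_mult; derive_C
  | |- is_Cderive (fun x => _ / _) _ _ => apply is_Cderive_div; [|derive_C|derive_C]
  | |- is_Cderive (fun x => _ ^ S _) _ _ => apply is_Cderive_pow; derive_C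
  | _ => idtac
  end.

Lemma RtoC_neq_0 (x : R) : x <> 0%R -> RtoC x <> 0.
Proof. intros H E; now apply RtoC_inj in E. Qed.

Ltac nz := cbv beta; repeat first [ assumption
  | match goal with |- _ /\ _ => split end
  | apply Cmult_neq_0 | apply Cpow_nz | apply RtoC_neq_0; lra ].

Ltac derive_eq := eapply is_Cderive_eq;
  [derive_C; try eassumption; nz
  |cbn [Z.of_nat Pos.of_succ_nat Pos.succ]; cbv beta].

Lemma near0_1_minus : near0 (fun z => 1 - z <> 0).
Proof.
apply (near0_neq (fun z => 1 - z) (0 - 1)).
- derive_C.
- replace (1 - 0) with (RtoC 1) by ring; apply C1_nz.
Qed.

Lemma near0_z_minus_1 : near0 (fun z => z - 1 <> 0).
Proof.
apply (near0_imp (fun z => 1 - z <> 0)); [|apply near0_1_minus].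
intros z Hz E; apply Hz; replace (1 - z) with (- (z - 1)) by ring; rewrite E; ring.
Qed.

Lemma near0_1_plus (c : C) : near0 (fun z => 1 + c * z <> 0).
Proof.
eapply (near0_neq (fun z => 1 + c * z)).
- derive_C.
- replace (1 + c * 0) with (RtoC 1) by ring; apply C1_nz.
Qed.

(** * Pfaff's, cubic, quadratic and sextic transformations *)

(** Pfaff's transformation replaces [b] by [1 - b] when the third parameter is [1], so [b = 1/2] is
    preserved. Here [lam] is the logarithmic derivative of [(1 - z)^a]. *)
Lemma hyp_pfaff_logder (a : C) (g : C -> C) :
  hyp_logder a (1 / 2) g ->
  near0 (fun z => is_Cderive (fun x => hypF a (1 / 2) 1 (x / (x - 1))) z
    ((g z + - (a / (1 - z))) * hypF a (1 / 2) 1 (z / (z - 1)))).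
Proof.
intros Hg.
pose proof (near0_and _ _ near0_1_minus near0_z_minus_1) as Hz1.
apply hyp_pullback with (c := a) (d := 1 / 2)
  (w := fun x => x / (x - 1)) (w1 := fun x => - (1 / (x - 1) ^ 2))
  (w2 := fun x => 2 / (x - 1) ^ 3) (lam := fun x => - (a / (1 - x)))
  (lam1 := fun x => - (a / (1 - x) ^ 2)); trivial;
  try (revert Hz1; apply near0_imp; intros z [Hz Hz']).
- derive_eq; field; nz.
- derive_eq; field; nz.
- derive_eq; field; nz.
- cbv beta; field; nz.
- intros Hz0 E; apply Hz0; replace z with (z / (z - 1) * (z - 1)) by (field; trivial).
  rewrite E; ring.
- cbv beta; field; nz.
- cbv beta; field; nz.
Qed.

Lemma log_derivative_ex (a b : C) (g : C -> C) :
  hyp_logder a b g -> exists l, is_Cderive g 0 l.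
Proof. intros [Hg _]; destruct (near0_center _ Hg) as [l [Hl _]]; eauto. Qed.

Lemma hyp_half_pfaff :
  near0 (fun z => hypF (1 / 2) (1 / 2) 1 (z / (z - 1)) ^ 2
                  = (1 - z) * hypF (1 / 2) (1 / 2) 1 z ^ 2).
Proof.
destruct (hyp_logder_ex (1 / 2) (1 / 2)) as [g Hg].
destruct (log_derivative_ex _ _ _ Hg) as [l Hl].
pose proof (hyp_pfaff_logder _ _ Hg) as Hp; destruct Hg as [_ HF].
set (F := hypF (1 / 2) (1 / 2) 1) in *.
apply (near0_imp (fun z => F (z / (z - 1)) ^ 2 - (1 - z) * F z ^ 2 = 0));
  [intros z; apply Ceq_minus|].
eapply (Cderive_linear_zero (fun z => F (z / (z - 1)) ^ 2 - (1 - z) * F z ^ 2)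
         (fun z => 2 * (g z + - (1 / 2 / (1 - z))))).
- generalize (near0_and _ _ Hp (near0_and _ _ HF near0_1_minus)).
  apply near0_imp; intros z [H1 [H2 Hz]].
  derive_eq; field; nz.
- derive_C; [exact Hl|].
  replace (1 - 0) with (RtoC 1) by ring; apply C1_nz.
- replace (0 / (0 - 1)) with (RtoC 0) by (field; nz).
  unfold F; rewrite hypF_0; ring.
Qed.

(** Stated for either primitive cube root of unity, to serve both [omega] and its square. The
    constant [2 om + 1] is a square root of [-3]. *)
Lemma hyp_sixth_half_cubic (om : C) :
  om * om = - (1) - om ->
  near0 (fun z =>
    hypF (1 / 6) (1 / 2) 1
        (3 * (2 * om + 1) * z * (1 - z) / (1 + om * z) ^ 3) ^ 2
      = (1 + om * z) * hypF (1 / 2) (1 / 2) 1 z ^ 2).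
Proof.
intros Hom.
assert (Hs : 2 * om + 1 <> 0).
{ intros E; apply (RtoC_neq_0 (-3)); [lra|].
  transitivity ((2 * om + 1) * (2 * om + 1)); [ring [Hom]|rewrite E; ring]. }
destruct (hyp_logder_ex (1 / 2) (1 / 2)) as [g Hg].
destruct (log_derivative_ex _ _ _ Hg) as [l Hl].
pose proof Hg as [_ HF].
set (F := hypF (1 / 2) (1 / 2) 1) in *.
pose proof (near0_1_plus om) as Hp.
set (w := fun x => 3 * (2 * om + 1) * x * (1 - x) / (1 + om * x) ^ 3).
assert (Hw : near0 (fun z => is_Cderive (fun x => hypF (1 / 6) (1 / 2) 1 (w x)) z
    ((g z + om / (2 * (1 + om * z))) * hypF (1 / 6) (1 / 2) 1 (w z)))).
{ apply hyp_pullback with (c := 1 / 2) (d := 1 / 2)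
    (* The square appears because [1 - w] is the cube of [(1 + om^2 x) / (1 + om x)]. *)
    (w1 := fun x => 3 * (2 * om + 1) * (1 + om ^ 2 * x) ^ 2 / (1 + om * x) ^ 4)
    (w2 := fun x => 3 * (2 * om + 1) *
       (2 * om ^ 2 * (1 + om ^ 2 * x) * (1 + om * x)
        - 4 * om * (1 + om ^ 2 * x) ^ 2) / (1 + om * x) ^ 5)
    (lam := fun x => om / (2 * (1 + om * x)))
    (lam1 := fun x => - (om ^ 2 / (2 * (1 + om * x) ^ 2))); unfold w; trivial;
    try (generalize (near0_and _ _ Hp near0_1_minus); apply near0_imp; intros z [Hz Hz1]).
  - derive_eq; field [Hom]; nz.
  - derive_eq; field [Hom]; nz.
  - derive_eq; field; nz.
  - field; replace (1 + om * 0) with (RtoC 1) by ring; nz.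
  - intros Hz0 E; apply (Cmult_neq_0 _ _ (Cmult_neq_0 _ _
      (Cmult_neq_0 3 (2 * om + 1) ltac:(nz) Hs) Hz0) Hz1).
    transitivity (3 * (2 * om + 1) * z * (1 - z) / (1 + om * z) ^ 3 * (1 + om * z) ^ 3).
    + field; nz.
    + rewrite E; ring.
  - cbv beta; field [Hom]; nz.
  - cbv beta; field [Hom]; nz. }
apply (near0_imp (fun z => hypF (1 / 6) (1 / 2) 1 (w z) ^ 2 - (1 + om * z) * F z ^ 2 = 0));
  [intros z; apply Ceq_minus|].
eapply (Cderive_linear_zero
         (fun z => hypF (1 / 6) (1 / 2) 1 (w z) ^ 2 - (1 + om * z) * F z ^ 2)
         (fun z => 2 * (g z + om / (2 * (1 + om * z))))).
- generalize (near0_and _ _ Hw (near0_and _ _ HF Hp)).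
  apply near0_imp; intros z [H1 [H2 Hz]].
  derive_eq; field; nz.
- derive_C; [exact Hl|].
  replace (1 + om * 0) with (RtoC 1) by ring; nz.
- replace (w 0) with (RtoC 0).
  + unfold F; rewrite !hypF_0; ring.
  + unfold w; field; replace (1 + om * 0) with (RtoC 1) by ring; nz.
Qed.

(** The product on the right has logarithmic derivative [g + (g - (1/6) / (1 - z))] by Pfaff, which
    is twice [g - (1/12) / (1 - z)]. *)
Lemma hyp_twelfth_quadratic :
  near0 (fun z =>
    hypF (1 / 12) (5 / 12) 1 (z ^ 2 / (4 * (z - 1))) ^ 2
      = hypF (1 / 6) (1 / 2) 1 z * hypF (1 / 6) (1 / 2) 1 (z / (z - 1))).
Proof.
destruct (hyp_logder_ex (1 / 6) (1 / 2)) as [g Hg].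
destruct (log_derivative_ex _ _ _ Hg) as [l Hl].
pose proof (hyp_pfaff_logder _ _ Hg) as Hp; pose proof Hg as [_ HF].
set (F := hypF (1 / 6) (1 / 2) 1) in *.
set (w := fun x => x ^ 2 / (4 * (x - 1))).
assert (Hw : near0 (fun z => is_Cderive (fun x => hypF (1 / 12) (5 / 12) 1 (w x)) z
    ((g z + - (1 / 12 / (1 - z))) * hypF (1 / 12) (5 / 12) 1 (w z)))).
{ apply hyp_pullback with (c := 1 / 6) (d := 1 / 2)
    (w1 := fun x => x * (x - 2) / (4 * (x - 1) ^ 2))
    (w2 := fun x => 1 / (2 * (x - 1) ^ 3))
    (lam := fun x => - (1 / 12 / (1 - x)))
    (lam1 := fun x => - (1 / 12 / (1 - x) ^ 2)); unfold w; trivial;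
    try (generalize (near0_and _ _ near0_z_minus_1 near0_1_minus);
         apply near0_imp; intros z [Hz Hz1]).
  - derive_eq; field; nz.
  - derive_eq; field; nz.
  - derive_eq; field; nz.
  - field; nz.
  - intros Hz0 E; apply (Cpow_nz z 2 Hz0).
    transitivity (z ^ 2 / (4 * (z - 1)) * (4 * (z - 1))); [field; nz|rewrite E; ring].
  - cbv beta; field; nz.
  - cbv beta; field; nz. }
apply (near0_imp (fun z => hypF (1 / 12) (5 / 12) 1 (w z) ^ 2 - F z * F (z / (z - 1)) = 0));
  [intros z; apply Ceq_minus|].
eapply (Cderive_linear_zero
         (fun z => hypF (1 / 12) (5 / 12) 1 (w z) ^ 2 - F z * F (z / (z - 1)))
         (fun z => 2 * (g z + - (1 / 12 / (1 - z))))).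
- generalize (near0_and _ _ Hw (near0_and _ _ HF (near0_and _ _ Hp near0_1_minus))).
  apply near0_imp; intros z [H1 [H2 [H3 Hz]]].
  derive_eq; field; nz.
- derive_C; [exact Hl|].
  replace (1 - 0) with (RtoC 1) by ring; nz.
- replace (0 / (0 - 1)) with (RtoC 0) by (field; nz).
  replace (w 0) with (RtoC 0) by (unfold w; field; nz).
  unfold F; rewrite !hypF_0; ring.
Qed.

(** The argument is [1728 / j] for the Legendre curve with parameter [z]. *)
Lemma hyp_twelfth_sextic :
  near0 (fun z =>
    hypF (1 / 12) (5 / 12) 1
        (27 * z ^ 2 * (1 - z) ^ 2 / (4 * (z ^ 2 - z + 1) ^ 3)) ^ 4
      = (z ^ 2 - z + 1) * hypF (1 / 2) (1 / 2) 1 z ^ 4).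
Proof.
destruct (hyp_logder_ex (1 / 2) (1 / 2)) as [g Hg].
destruct (log_derivative_ex _ _ _ Hg) as [l Hl].
pose proof Hg as [_ HF].
set (F := hypF (1 / 2) (1 / 2) 1) in *.
assert (Hp : near0 (fun z => z ^ 2 - z + 1 <> 0)).
{ eapply (near0_neq (fun z => z ^ 2 - z + 1)); [derive_C|].
  replace (0 ^ 2 - 0 + 1) with (RtoC 1) by ring; nz. }
set (w := fun x => 27 * x ^ 2 * (1 - x) ^ 2 / (4 * (x ^ 2 - x + 1) ^ 3)).
assert (Hw : near0 (fun z => is_Cderive (fun x => hypF (1 / 12) (5 / 12) 1 (w x)) z
    ((g z + (2 * z - 1) / (4 * (z ^ 2 - z + 1))) * hypF (1 / 12) (5 / 12) 1 (w z)))).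
{ apply hyp_pullback with (c := 1 / 2) (d := 1 / 2)
    (* With [s = x - x^2] one has [w = 27 s^2 / (4 (1 - s)^3)] and
       [dw/ds = 27 s (2 + s) / (4 (1 - s)^4)]; the factor [1 - 2 x] is [s']. *)
    (w1 := fun x => 27 * x * (1 - x) * (2 + x - x ^ 2) * (1 - 2 * x)
                    / (4 * (x ^ 2 - x + 1) ^ 4))
    (w2 := fun x => 27 / 4 *
      ((2 * ((1 + x - x ^ 2) * (1 - 2 * x) ^ 2 - x * (1 - x) * (2 + x - x ^ 2)))
         / (x ^ 2 - x + 1) ^ 4
       + 4 * x * (1 - x) * (2 + x - x ^ 2) * (1 - 2 * x) ^ 2 / (x ^ 2 - x + 1) ^ 5))
    (lam := fun x => (2 * x - 1) / (4 * (x ^ 2 - x + 1)))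
    (lam1 := fun x => 1 / (2 * (x ^ 2 - x + 1))
                      - (2 * x - 1) ^ 2 / (4 * (x ^ 2 - x + 1) ^ 2));
    unfold w; trivial;
    try (generalize (near0_and _ _ Hp near0_1_minus); apply near0_imp; intros z [Hz Hz1]).
  - derive_eq; field; nz.
  - derive_eq; field; nz.
  - derive_eq; field; nz.
  - field; replace (0 ^ 2 - 0 + 1) with (RtoC 1) by ring; nz.
  - intros Hz0 E; apply (Cmult_neq_0 _ _ (Cmult_neq_0 27 _ ltac:(nz)
      (Cpow_nz z 2 Hz0)) (Cpow_nz _ 2 Hz1)).
    transitivity (27 * z ^ 2 * (1 - z) ^ 2 / (4 * (z ^ 2 - z + 1) ^ 3)
                  * (4 * (z ^ 2 - z + 1) ^ 3)); [field; nz|rewrite E; ring].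
  - cbv beta; field; nz.
  - cbv beta; field; nz. }
apply (near0_imp (fun z => hypF (1 / 12) (5 / 12) 1 (w z) ^ 4 - (z ^ 2 - z + 1) * F z ^ 4 = 0));
  [intros z; apply Ceq_minus|].
eapply (Cderive_linear_zero
         (fun z => hypF (1 / 12) (5 / 12) 1 (w z) ^ 4 - (z ^ 2 - z + 1) * F z ^ 4)
         (fun z => 4 * (g z + (2 * z - 1) / (4 * (z ^ 2 - z + 1))))).
- generalize (near0_and _ _ Hw (near0_and _ _ HF Hp)).
  apply near0_imp; intros z [H1 [H2 Hz]].
  derive_eq; field; nz.
- derive_C; [exact Hl|].
  replace (0 ^ 2 - 0 + 1) with (RtoC 1) by ring; nz.
- replace (w 0) with (RtoC 0).
  + unfold F; rewrite !hypF_0; ring.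
  + unfold w; field; replace (0 ^ 2 - 0 + 1) with (RtoC 1) by ring; nz.
Qed.

(** * Neighbourhoods of [0], the cube root of unity, the four identities *)

(** The balls of [locally] are products of intervals; one of radius [d / sqrt 2] fits in the disc of
    radius [d]. *)
Lemma near0_locally (P : C -> Prop) : near0 P -> locally (RtoC 0) P.
Proof.
intros [d [Hd HP]].
assert (Hs : (0 < sqrt 2)%R) by (apply sqrt_lt_R0; lra).
exists (mkposreal _ (Rdiv_lt_0_compat _ _ Hd Hs)); intros z Hz; change C in z; apply HP.
apply C_NormedModule_mixin_compat2 in Hz; simpl pos in Hz.
change (Cmod (z - 0) < sqrt 2 * (d / sqrt 2))%R in Hz.
replace (z - 0) with z in Hz by ring.
now replace (sqrt 2 * (d / sqrt 2))%R with d in Hz by (field; lra).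
Qed.

Lemma omega_double : 2 * omega + 1 = RtoC (sqrt 3) * Ci.
Proof. unfold omega; field; nz. Qed.

Lemma omega_square : omega * omega = - (1) - omega.
Proof.
assert (H3 : RtoC (sqrt 3) * RtoC (sqrt 3) = 3)
  by (rewrite <- RtoC_mult, sqrt_sqrt; trivial; lra).
assert (Hi : Ci * Ci = - (1))
  by (apply injective_projections; simpl; ring).
unfold omega; field [H3 Hi]; nz.
Qed.

Theorem corollary7p1 :
  locally (RtoC 0) (fun z : C =>
    hypF (1/6) (1/2) 1
        (3 * RtoC (sqrt 3) * Ci * z * (1 - z) / (1 + omega * z) ^ 3) ^ 2
      = - omega ^ 2 * hypF (1/2) (1/2) 1 z ^ 2
        - omega * hypF (1/2) (1/2) 1 (z / (z - 1)) ^ 2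
    /\
    hypF (1/6) (1/2) 1
        (- (3 * RtoC (sqrt 3) * Ci * z * (1 - z) / (z + omega) ^ 3)) ^ 2
      = - omega * hypF (1/2) (1/2) 1 z ^ 2
        - omega ^ 2 * hypF (1/2) (1/2) 1 (z / (z - 1)) ^ 2
    /\
    hypF (1/12) (5/12) 1 (z ^ 2 / (4 * (z - 1))) ^ 2
      = hypF (1/6) (1/2) 1 z * hypF (1/6) (1/2) 1 (z / (z - 1))
    /\
    hypF (1/12) (5/12) 1
        (27 * z ^ 2 * (1 - z) ^ 2 / (4 * (z ^ 2 - z + 1) ^ 3)) ^ 4
      = hypF (1/2) (1/2) 1 z ^ 4
        + hypF (1/2) (1/2) 1 (z / (z - 1)) ^ 4
        - hypF (1/2) (1/2) 1 z ^ 2 * hypF (1/2) (1/2) 1 (z / (z - 1)) ^ 2).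
Proof.
pose proof omega_square as Ho.
set (om2 := omega * omega).
assert (Ho2 : om2 * om2 = - (1) - om2) by (unfold om2; ring [Ho]).
apply near0_locally.
generalize (near0_and _ _ (hyp_sixth_half_cubic omega Ho)
  (near0_and _ _ (hyp_sixth_half_cubic om2 Ho2)
    (near0_and _ _ hyp_twelfth_quadratic
      (near0_and _ _ hyp_twelfth_sextic hyp_half_pfaff)))).
apply near0_imp; intros z [E1 [E2 [E3 [E4 E5]]]].
split; [|split; [|split]].
- replace (3 * RtoC (sqrt 3) * Ci) with (3 * (2 * omega + 1))
    by (rewrite omega_double; ring).
  (* What remains is [1 + omega z = - omega^2 - omega (1 - z)]. *)
  rewrite E1, E5; ring [Ho].
(* Here [z + omega = omega (1 + omega^2 z)] with [omega^3 = 1], and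
   [2 omega^2 + 1 = - (2 omega + 1)] accounts for the sign. *)
- replace (- (3 * RtoC (sqrt 3) * Ci * z * (1 - z) / (z + omega) ^ 3))
    with (3 * (2 * om2 + 1) * z * (1 - z) / (1 + om2 * z) ^ 3).
  + rewrite E2, E5; unfold om2; ring [Ho].
  + replace ((z + omega) ^ 3) with ((1 + om2 * z) ^ 3) by (unfold om2; ring [Ho]).
    replace (3 * RtoC (sqrt 3) * Ci) with (3 * (2 * omega + 1))
      by (rewrite omega_double; ring).
    unfold Cdiv; set (i := / _); unfold om2; ring [Ho].
- exact E3.
(* By Pfaff the right side is [1 + (1 - z)^2 - (1 - z) = z^2 - z + 1] times the fourth power. *)
- rewrite E4.
  replace (hypF (1 / 2) (1 / 2) 1 (z / (z - 1)) ^ 4)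
    with ((hypF (1 / 2) (1 / 2) 1 (z / (z - 1)) ^ 2) ^ 2) by ring.
  rewrite E5; ring.
Qed.
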